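(* Let $k\ge 0$ be an integer. There exists a dominant polynomial map $f:\mathbb{C}^2\to\mathbb{C}^2$ with $\mu_f=k+1$ and such that $\mathbb{C}^2\setminus f(\mathbb{C}^2)$ has at least one isolated point if and only if $k\ge 1$.
   Context: A polynomial map $f:\mathbb{C}^2\to\mathbb{C}^2$ is dominant if $f(\mathbb{C}^2)$ is dense in $\mathbb{C}^2$; $\mu_f$ denotes the number of preimages under $f$ of a generic point of $\mathbb{C}^2$. *)

(* Defs.v *)
From mathcomp Require Import all_boot all_algebra.
From mathcomp Require Import Rstruct.
From mathcomp Require Export complex.
From mathcomp Require Export mpoly.
Import GRing.Theory Num.Theory.
Local Open Scope ring_scope.

Definition C : numClosedFieldType := complex Rdefinitions.R.

Definition val2 (x : C * C) : 'I_2 -> C :=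
  fun i => if val i == 0%N then x.1 else x.2.

Definition polymap (P : {mpoly C[2]} * {mpoly C[2]}) (x : C * C) : C * C :=
  (P.1.@[val2 x], P.2.@[val2 x]).

(* l^1 distance on C^2 (induces the Euclidean topology). *)
Definition dist2 (x y : C * C) : C := `|x.1 - y.1| + `|x.2 - y.2|.

Definition dominant (f : C * C -> C * C) : Prop :=
  forall (y : C * C) (eps : C), 0 < eps -> exists x, dist2 (f x) y < eps.

Definition fiber_card (f : C * C -> C * C) (y : C * C) (m : nat) : Prop :=
  exists s : seq (C * C),
    [/\ uniq s, size s = m & forall x, f x = y <-> x \in s].

(* mu_f = m : a generic point (every point off a proper algebraic curve
   q = 0, q a nonzero polynomial) has exactly m preimages. *)
Definition generic_fiber_card (f : C * C -> C * C) (m : nat) : Prop :=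
  exists q : {mpoly C[2]},
    q != 0 /\ forall y : C * C, q.@[val2 y] != 0 -> fiber_card f y m.

Definition isolated_nonvalue (f : C * C -> C * C) (p : C * C) : Prop :=
  (forall x, f x <> p) /\
  exists eps : C, 0 < eps /\
    forall q : C * C, q <> p -> dist2 q p < eps -> exists x, f x = q.

(* Main.v *)
(* For k >= 1, the map f(x, y) = (x v, x + v^k) with v = xy - 1 omits exactly
   the origin, and the k+1 preimages of a generic (a, b) correspond to the
   roots v of T^(k+1) - b T + a.

   For k = 0, generic injectivity makes f birational: let z be a primitive
   element of C(x, y) over C(f) and M(u, v, T) an equation for z over C[u,
   v] of minimal degree in T; above a generic (u, v), every root T of M is
   the value of z at some preimage, so M has a single root there, which is
   then a rational function of (u, v). Hence x and y are rational functions
   of f. If, written in lowest terms, one of them, A / B, has B vanishing at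
   the omitted point p, then the identity B(f) x = A(f) shows that no point
   of the curve B = 0 where A does not vanish is a value of f, and such
   points accumulate at p. Otherwise the inverse is regular at p and
   provides a preimage of p. *)
Require Import Defs.
From HB Require Import structures.
From mathcomp Require Import all_boot all_order all_algebra.
From mathcomp Require Import generic_quotient fraction polyXY separable.
From mathcomp Require Import ring zify.

Set Implicit Arguments.
Unset Strict Implicit.
Unset Printing Implicit Defensive.
Import Order.TTheory GRing.Theory Num.Theory.
Local Open Scope ring_scope.

(** * Fraction fields and primitive elements *)

Local Notation "x %:F" := (FracField.tofrac x).

Lemma frac_numden (R : idomainType) (x : {fraction R}) :
  x * (\d_(repr x))%:F = (\n_(repr x))%:F.
Proof.
rewrite -{1}[x]reprK; move: (repr x) => y; unlock FracField.tofrac.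
rewrite -[LHS]FracField.pi_mul; apply/eqmodP; rewrite /= FracField.equivfE.
by rewrite /FracField.mulf !numden_Ratio ?mulr1 ?oner_eq0 ?denom_ratioP 1?mulrC.
Qed.

Section FracLift.
Variables (R : idomainType) (K : fieldType) (f : {rmorphism R -> K}).
Hypothesis f_inj : injective f.

(* The injectivity argument is only there to let the morphism instances below
   be inferred. *)
Definition frac_lift of injective f := fun x : {fraction R} =>
  f (\n_(repr x)) / f (\d_(repr x)).
Local Notation lift := (frac_lift f_inj).

Lemma frac_liftE x a b : b != 0 -> x * b%:F = a%:F -> lift x = f a / f b.
Proof.
move=> b0 xba; have f0 c : (f c == 0) = (c == 0).
  by rewrite -(inj_eq f_inj) rmorph0.
apply/eqP; rewrite eqr_div ?f0 ?denom_ratioP // -!rmorphM /= inj_eq //.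
by rewrite -tofrac_eq !rmorphM /= -frac_numden -xba mulrAC.
Qed.

Lemma frac_lift_tofrac a : lift a%:F = f a.
Proof.
by rewrite (@frac_liftE _ a 1) ?oner_eq0 ?rmorph1 ?mulr1 // divr1.
Qed.

Let fN0 c : c != 0 -> f c != 0.
Proof. by apply: contra_neq => fc; apply: f_inj; rewrite rmorph0. Qed.

Lemma frac_lift_is_zmod_morphism : zmod_morphism lift.
Proof.
move=> x y; have [dx dy] := (denom_ratioP (repr x), denom_ratioP (repr y)).
rewrite (@frac_liftE (x - y)
  (\n_(repr x) * \d_(repr y) - \n_(repr y) * \d_(repr x))
  (\d_(repr x) * \d_(repr y))) ?mulf_neq0 //; last first.
  rewrite rmorphB !rmorphM /= -!frac_numden mulrBl !mulrA; congr (_ - _).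
  by rewrite mulrAC.
rewrite rmorphB !rmorphM /= mulrBl /frac_lift; congr (_ - _).
  by rewrite -mulf_div divff ?mulr1 ?fN0.
by rewrite [f (\d_(repr x)) * _]mulrC -mulf_div divff ?mulr1 ?fN0.
Qed.
HB.instance Definition _ :=
  GRing.isZmodMorphism.Build _ _ lift frac_lift_is_zmod_morphism.

Lemma frac_lift_is_monoid_morphism : monoid_morphism lift.
Proof.
split=> [|x y]; first by rewrite -[1]tofrac1 frac_lift_tofrac rmorph1.
have [dx dy] := (denom_ratioP (repr x), denom_ratioP (repr y)).
rewrite (@frac_liftE (x * y) (\n_(repr x) * \n_(repr y))
  (\d_(repr x) * \d_(repr y))) ?mulf_neq0 //; last first.
  by rewrite !rmorphM /= -!frac_numden mulrACA.
by rewrite !rmorphM /= -mulf_div.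
Qed.
HB.instance Definition _ :=
  GRing.isMonoidMorphism.Build _ _ lift frac_lift_is_monoid_morphism.
End FracLift.

Lemma frac_poly_denom (R : idomainType) (p : {poly {fraction R}}) :
  exists (d : R) (q : {poly R}),
    d != 0 /\ d%:F *: p = map_poly (@FracField.tofrac R) q.
Proof.
elim/poly_ind: p => [|p c [d [q [d0 dp]]]].
  by exists 1, 0; rewrite oner_eq0 scaler0 rmorph0.
set e := \d_(repr c); set n := \n_(repr c).
exists (d * e), (e *: q * 'X + (d * n)%:P); split.
  by rewrite mulf_neq0 ?denom_ratioP.
rewrite [RHS]rmorphD [X in _ = X + _]rmorphM /= map_polyX map_polyC map_polyZ /= -dp.
rewrite !rmorphM /= -frac_numden scalerDr -!scalerAl scalerA mulrC.
by congr (_ + _); rewrite -mul_polyC -!polyCM; congr _%:P; ring.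
Qed.

Section PrimitiveElement.
Variables (R : idomainType) (phi : {rmorphism R -> R}).
Hypotheses (charR : [pchar R] =i pred0) (phi_inj : injective phi).

(** Through [phi], which will be the pullback along f, the fraction field of [R] is an extension of
    itself in characteristic 0. The primitive element theorem applies there, and clearing
    denominators brings its conclusion back to [R]. *)
Lemma primitive_element_domain (x y : R) (p q : {poly R}) :
    p != 0 -> q != 0 -> (map_poly phi p).[x] = 0 -> (map_poly phi q).[y] = 0 ->
  exists (z D : R) (N1 N2 : {poly R}),
    [/\ D != 0, phi D * x = (map_poly phi N1).[z]
      & phi D * y = (map_poly phi N2).[z]].
Proof.
move=> p0 q0 px qy; pose tF : {rmorphism R -> {fraction R}} := @FracField.tofrac R.
have tF_inj : injective tF by move=> a b /eqP; rewrite tofrac_eq => /eqP.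
have inj : injective (tF \o phi) by move=> a b /tF_inj/phi_inj.
pose iota : {rmorphism {fraction R} -> {fraction R}} := frac_lift inj.
have iotaE (r : {poly R}) (w : R) :
    (map_poly iota (map_poly tF r)).[tF w] = tF (map_poly phi r).[w].
  rewrite -horner_map -!map_poly_comp; congr (_.[_]); apply: eq_map_poly => c /=.
  exact: frac_lift_tofrac.
have mp0 (r : {poly R}) : r != 0 -> map_poly tF r != 0.
  by move=> r0; rewrite map_poly_eq0_id0 // tofrac_eq0 lead_coef_eq0.
have rp : root (map_poly iota (map_poly tF p)) (tF x).
  by rewrite /root iotaE px rmorph0.
have rq : root (map_poly iota (map_poly tF q)) (tF y).
  by rewrite /root iotaE qy rmorph0.
have charF : [pchar {fraction R}] =i pred0.
  move=> n; rewrite -[RHS](charR n) !inE; congr (_ && _).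
  by rewrite -(rmorph_nat tF) tofrac_eq0.
(* The primitive element obtained is [tF x *+ n - tF y], an integral combination, so it comes from
   an element of [R]. *)
have [n [[r1 rx] [r2 ry]]] := pchar0_PET (mp0 _ q0) rq (mp0 _ p0) rp charF.
have [d1 [s1 [d10 ds1]]] := frac_poly_denom r1.
have [d2 [s2 [d20 ds2]]] := frac_poly_denom r2.
have clear (d : R) (r : {poly {fraction R}}) s w v : d%:F *: r = map_poly tF s ->
    (map_poly iota r).[tF w] = tF v -> phi d * v = (map_poly phi s).[w].
  move=> dr rv; apply: tF_inj; rewrite -iotaE -dr map_polyZ hornerZ rv rmorphM.
  by rewrite /= frac_lift_tofrac.
have Dz : tF (x *+ n - y) = tF x *+ n - tF y by rewrite rmorphB rmorphMn.
have ey : phi d1 * y = (map_poly phi s1).[x *+ n - y].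
  by apply: (clear _ _ _ _ _ ds1); rewrite Dz.
have ex : phi d2 * x = (map_poly phi s2).[x *+ n - y].
  by apply: (clear _ _ _ _ _ ds2); rewrite Dz.
exists (x *+ n - y), (d1 * d2), (d1 *: s2), (d2 *: s1).
rewrite mulf_neq0 // !map_polyZ !hornerZ -ex -ey !rmorphM /=.
by split=> //; ring.
Qed.
End PrimitiveElement.

(** * Bivariate polynomials and their zeros *)


Section Substitution.
Variables (F : fieldType).
Local Notation R2 := {poly {poly F}}.

(** Pullback of [h] along the map (f, g): the outer variable is the first argument of [.[x, y]],
    hence the one replaced by [f]. *)
Definition subst2 (f g h : R2) : R2 :=
  (map_poly (horner_eval g \o map_poly (polyC \o polyC)) h).[f].
HB.instance Definition _ f g := GRing.RMorphism.copy (subst2 f g)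
  (horner_eval f \o map_poly (horner_eval g \o map_poly (polyC \o polyC))).

Lemma subst2E f g (h : R2) x y : (subst2 f g h).[x, y] = h.[f.[x, y], g.[x, y]].
Proof.
rewrite /subst2 -[LHS]/((horner_eval y \o horner_eval x%:P) _.[f]).
rewrite -horner_map -map_poly_comp /= /horner_eval.
rewrite -[RHS]horner_evalE -horner_map /=; congr (_.[_]); last first.
  by rewrite /horner_eval hornerC.
apply: eq_map_poly => c /=; rewrite /horner_eval.
rewrite -[LHS]/((horner_eval y \o horner_eval x%:P) _.[g]).
rewrite -horner_map -map_poly_comp /= /horner_eval; congr (_.[_]).
by rewrite map_poly_id // => a _ /=; rewrite !hornerC.
Qed.

(** [H] is D^m G(A1 / D, A2 / D), a polynomial once m is large. Phrasing this through evaluations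
    [psi] avoids fractions and allows both [R2] and [{poly R2}] as [S]. *)
Lemma clear_denominators (S : comNzRingType) (c : {rmorphism F -> S}) (G : R2)
    (A1 A2 D : S) :
  exists (H : S) (m : nat), forall (psi : {rmorphism S -> F}) (a b : F),
    (forall t, psi (c t) = t) -> psi D * a = psi A1 -> psi D * b = psi A2 ->
  psi H = psi D ^+ m * G.[a, b].
Proof.
have inner (g0 : {poly F}) : exists (H : S) (m : nat),
    forall (psi : {rmorphism S -> F}) (b : F),
    (forall t, psi (c t) = t) -> psi D * b = psi A2 ->
  psi H = psi D ^+ m * g0.[b].
  elim/poly_ind: g0 => [|g e [H [m HP]]].
    by exists 0, 0%N => psi b _ _; rewrite rmorph0 horner0 mulr0.
  exists (H * A2 + c e * D ^+ m.+1), m.+1 => psi b psic Db.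
  rewrite rmorphD !rmorphM rmorphXn /= psic -Db (HP _ _ psic Db) !hornerE exprS /=.
  ring.
elim/poly_ind: G => [|G g [H [m HP]]].
  by exists 0, 0%N => psi a b _ _ _; rewrite rmorph0 !horner0 mulr0.
have [Hg [n HgP]] := inner g.
exists (H * A1 * D ^+ n + Hg * D ^+ m.+1), (m.+1 + n)%N => psi a b psic Da Db.
rewrite rmorphD !rmorphM !rmorphXn /= (HP _ _ _ psic Da Db) (HgP _ _ psic Db).
by rewrite -Da !hornerE exprD exprS /=; ring.
Qed.

End Substitution.

Section Roots.
Variable F : numFieldType.
Local Notation R2 := {poly {poly F}}.

Lemma small_nonroot (p : {poly F}) (d : F) :
  p != 0 -> 0 < d -> exists u, [/\ u != 0, `|u| < d & p.[u] != 0].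
Proof.
(* These [size p] distinct points outnumber the roots of [p]; denominators start at 2 to stay
   strictly below [d]. *)
move=> p0 d0; pose s := [seq d / i.+2%:R | i <- iota 0 (size p)].
have us : uniq s.
  rewrite map_inj_uniq ?iota_uniq // => i j /(mulfI (lt0r_neq0 d0)).
  by move/invr_inj/eqP; rewrite eqr_nat => /eqP[].
have : ~~ all (root p) s.
  apply/negP => rs; have := max_poly_roots p0 rs us.
  by rewrite size_map size_iota ltnn.
move=> /allPn[_ /mapP[i _ ->] pu]; exists (d / i.+2%:R); split => //.
  by rewrite lt0r_neq0 // divr_gt0 // ltr0n.
rewrite ger0_norm ?divr_ge0 ?ltW // ltr_pdivrMr ?ltr0n //.
by rewrite ltr_pMr // ltr1n.
Qed.

Lemma poly_vanish (p : {poly F}) : (forall x, p.[x] = 0) -> p = 0.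
Proof.
move=> pz; apply/eqP; apply: contraT => /small_nonroot/(_ ltr01)[u [_ _]].
by rewrite pz eqxx.
Qed.

Lemma poly2_vanish (p : R2) : (forall x y, p.[x, y] = 0) -> p = 0.
Proof.
move=> pz; rewrite -[p]swapXYK; suff -> : swapXY p = 0 by rewrite rmorph0.
apply/polyP => i; rewrite coef0; apply: poly_vanish => x.
have : map_poly (horner_eval x) (swapXY p) = 0.
  by apply: poly_vanish => y; rewrite -horner_polyC pz.
by move/(congr1 (fun q : {poly F} => q`_i)); rewrite coef_map coef0.
Qed.

Lemma poly_bounded (p : {poly F}) :
  exists2 M, 0 < M & forall u, `|u| <= 1 -> `|p.[u]| <= M.
Proof.
elim/poly_ind: p => [|p c [M M0 HM]].
  by exists 1 => // u _; rewrite horner0 normr0 ler01.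
exists (M + `|c|) => [|u u1]; first by rewrite ltr_wpDr.
rewrite hornerMXaddC (le_trans (ler_normD _ _)) // lerD2r normrM.
by rewrite -[M]mulr1 ler_pM // HM.
Qed.

Lemma poly_near0 (p : {poly F}) (e : F) : 0 < e ->
  exists2 d, 0 < d & forall u, `|u| < d -> `|p.[u] - p.[0]| < e.
Proof.
move=> e0; have [M M0 HM] := poly_bounded (p %/ 'X).
have pE : p = (p %/ 'X) * 'X + (p.[0])%:P.
  by rewrite {1}(divp_eq p 'X) -['X]subr0 -polyC0 modp_XsubC.
(* This radius is at most 1, where the bound [M] holds, and small enough that [M * |u| < e]. *)
exists (e / (M + e)) => [|u]; first by rewrite divr_gt0 ?addr_gt0.
have Me0 : 0 < M + e by rewrite addr_gt0.
rewrite ltr_pdivlMr // => ue.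
have u1 : `|u| <= 1.
  by rewrite -(ler_pM2r Me0) mul1r (le_trans (ltW ue)) // ler_wpDl // ltW.
rewrite [p in p.[u]]pE hornerD hornerM hornerX hornerC addrK normrM.
rewrite (le_lt_trans (ler_wpM2r _ (HM _ u1))) // (le_lt_trans _ ue) //.
by rewrite mulrDr mulrC ler_wpDr // mulr_ge0 // ltW.
Qed.

End Roots.

Section NearbyRoots.
Variable F : numClosedFieldType.
Local Notation R2 := {poly {poly F}}.

(* If every root [r] satisfies [e <= `|r|], then [`|v - r| <= 2 `|r|] for
   [`|v| <= e]. *)
Lemma norm_horner_le (p : {poly F}) (e v : F) :
  (forall r, root p r -> e <= `|r|) -> `|v| <= e ->
  `|p.[v]| <= 2 ^+ size p * `|p.[0]|.
Proof.
move=> pe ve; have [rs prs] := closed_field_poly_normal p.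
have [->|p0] := eqVneq p 0; first by rewrite !horner0 normr0 mulr0.
have sz : (size rs <= size p)%N.
  by rewrite prs size_scale ?lead_coef_eq0 // size_prod_XsubC.
have rse r : r \in rs -> e <= `|r|.
  by move=> rr; apply: pe; rewrite prs rootZ ?lead_coef_eq0 ?root_prod_XsubC.
have H : `|(\prod_(z <- rs) ('X - z%:P)).[v]| <=
    2 ^+ size rs * `|(\prod_(z <- rs) ('X - z%:P)).[0]|.
  elim: rs {prs sz} rse => [|r rs IH] rse.
    by rewrite !big_nil !hornerC expr0 mul1r.
  rewrite !big_cons !hornerM !normrM exprS mulrACA ler_pM //; last first.
    by apply: IH => z zr; apply: rse; rewrite inE zr orbT.
  rewrite !hornerXsubC sub0r normrN (le_trans (ler_normB _ _)) //.
  by rewrite mulr_natl mulr2n lerD2r (le_trans ve) // rse ?mem_head.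
rewrite prs !hornerZ !normrM mulrCA ler_wpM2l // (le_trans H) //.
by rewrite ler_wpM2r // -prs ler_eXn2l ?ltr1n.
Qed.

Lemma pos_lower_bound (a b : F) :
  0 < a -> 0 < b -> exists2 c, 0 < c & c <= a /\ c <= b.
Proof.
move=> a0 b0; have [ab|ba] := real_leP (gtr0_real a0) (gtr0_real b0).
  by exists a.
by exists b => //; rewrite ltW.
Qed.

(** The root v = 0 of B(0, v) persists for small u. Fix a small v0 with B(0, v0) nonzero. If all
    roots v of B(u, v) had modulus at least e, [norm_horner_le] would bound |B(u, v0)| by a constant
    times |B(u, 0)|, which tends to 0 with u, whereas B(u, v0) tends to B(0, v0). *)
Lemma small_root (B : R2) (r : {poly F}) (e : F) :
    r != 0 -> 0 < e -> B.[0, 0] = 0 -> B.[0%:P] != 0 ->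
  exists u v, [/\ `|u| < e, `|v| < e, r.[u] != 0 & B.[u, v] = 0].
Proof.
move=> r0 e0 B00 B0; have [v0 [_ v0e Bv0]] := small_nonroot B0 e0.
pose g := (swapXY B).[v0%:P]; pose h := (swapXY B).[0%:P].
have gE u : g.[u] = B.[u, v0] by rewrite horner2_swapXY.
have hE u : h.[u] = B.[u, 0] by rewrite horner2_swapXY.
(* [sizeY B] bounds the size of B(u, v) in v for every u, so [K] is uniform in u. *)
pose K : F := 2 ^+ sizeY B; have K0 : 0 < K by rewrite exprn_gt0.
have g0 : 0 < `|g.[0]| by rewrite gE normr_gt0.
have [d1 d10 Hg] := poly_near0 g (divr_gt0 g0 (ltr0Sn _ 1)).
have [d2 d20 Hh] := poly_near0 h (divr_gt0 g0 (mulr_gt0 (ltr0Sn _ 1) K0)).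
have [d3 d30 [d31 d32]] := pos_lower_bound d10 d20.
have [d d0 [dd3 de]] := pos_lower_bound d30 e0.
have [u [_ ud ru]] := small_nonroot r0 d0.
have ud3 := lt_le_trans ud dd3.
have {Hg} Hg := Hg u (lt_le_trans ud3 d31).
have {Hh} Hh := Hh u (lt_le_trans ud3 d32).
have [rs prs] := closed_field_poly_normal B.[u%:P].
have rootE v : B.[u%:P] != 0 -> root B.[u%:P] v = (v \in rs).
  by move=> Bu; rewrite prs rootZ ?lead_coef_eq0 // root_prod_XsubC.
have [Bu0|Bu] := eqVneq B.[u%:P] 0.
  by exists u, 0; rewrite normr0 ru Bu0 horner0 (lt_le_trans ud de).
have [/hasP[v vrs ve]|/hasPn nors] := boolP (has (fun v => `|v| < e) rs).
  exists u, v; split; rewrite ?(lt_le_trans ud de) //.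
  by apply/eqP; rewrite -/(root _ _) rootE.
have big v : root B.[u%:P] v -> e <= `|v|.
  rewrite rootE // => /nors; rewrite -real_leNgt ?normr_real //.
  exact: gtr0_real.
have := norm_horner_le big (ltW v0e); rewrite -gE -hE => gh.
have {}gh : `|g.[u]| <= K * `|h.[u]|.
  rewrite (le_trans gh) // ler_wpM2r // ler_weXn2l ?ler1n //.
  exact: max_size_evalC.
rewrite [h.[0]]hE B00 subr0 in Hh.
have Kh : K * `|h.[u]| < `|g.[0]| / 2.
  by rewrite mulrC -ltr_pdivlMr // -mulrA -invfM.
have := le_lt_trans (ler_distD g.[u] g.[0] 0).
rewrite !subr0 distrC => /(_ _ (ltrD Hg (le_lt_trans gh Kh))).
by rewrite -splitr ltxx.
Qed.
End NearbyRoots.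

(** * Poles of rational functions *)


Section Poles.
Variable F : numClosedFieldType.
Local Notation R2 := {poly {poly F}}.

Lemma subst2_shiftK (a b : F) (h : R2) :
  subst2 ('X - a%:P%:P) ('Y - b%:P%:P)
    (subst2 ('X + a%:P%:P) ('Y + b%:P%:P) h) = h.
Proof.
apply/eqP; rewrite -subr_eq0; apply/eqP; apply: poly2_vanish => x y.
by rewrite !hornerD !hornerN !subst2E !hornerE !subrK subrr.
Qed.

(** Poles of A / B accumulate at the origin. The origin itself is excluded because only the points
    around an isolated omitted point are known to be values. *)
Definition has_pole0 (A B : R2) := forall e : F, 0 < e -> exists u v : F,
  [/\ (u != 0) || (v != 0), `|u| < e, `|v| < e, B.[u, v] = 0 & A.[u, v] != 0].

(** The polynomial [r] involves the inner variable y alone. The identity prevents A and B from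
    vanishing together wherever r(y) is nonzero; the remaining obstruction, a common factor y, is
    removed by induction on the size of [r]. *)
Lemma regular_or_pole0_Bezout (A B U V : R2) (r : {poly F}) :
    B != 0 -> r != 0 -> U * A + V * B = r%:P ->
  exists A' B' : R2,
    [/\ A * B' = A' * B, B' != 0 & B'.[0, 0] != 0 \/ has_pole0 A' B'].
Proof.
have [n] := ubnP (size r); elim: n A B r => // n IH A B r rn B0 r0 Bez.
have [B00|B00] := eqVneq B.[0, 0] 0; last by exists A, B; split=> //; left.
have swap0 (G : R2) : (swapXY G).[0%:P] = map_poly (horner_eval 0) G.
  exact: horner_swapXY.
have div0 (G : R2) : (swapXY G).[0%:P] = 0 -> exists G' : R2, G = 'Y * G'.
  rewrite swap0 => G0; exists (map_poly (fun c => c %/ 'X) G).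
  apply/polyP => i; rewrite coefCM coef_map_id0 ?div0p // mulrC.
  rewrite {1}(divp_eq G`_i 'X) -['X]subr0 -polyC0 modp_XsubC.
  move/(congr1 (fun q : {poly F} => q`_i)): G0.
  by rewrite coef_map coef0 /= /horner_eval => ->; rewrite addr0.
(* If B is not identically zero on the line y = 0, it has zeros near the origin whose y is nonzero
   and not a root of [r]. *)
have [Bx|Bx] := eqVneq (swapXY B).[0%:P] 0; last first.
  exists A, B; split=> //; right => e e0.
  have rX0 : r * 'X != 0 by rewrite mulf_neq0 ?polyX_eq0.
  have [|v [u [ve ue]]] := small_root rX0 e0 _ Bx.
    by rewrite horner2_swapXY.
  rewrite horner2_swapXY hornerM hornerX mulf_eq0 negb_or => /andP[rv v0] Buv.
  exists u, v; rewrite v0 orbT; split=> //; apply: contra rv => /eqP Auv.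
  have := congr1 (fun G : R2 => G.[u, v]) Bez.
  by rewrite !hornerE Auv Buv !mulr0 addr0 => <-.
have [Ax|Ax] := eqVneq (swapXY A).[0%:P] 0; last first.
  exists A, B; split=> //; right => e e0.
  have [u [u0 ue Au]] := small_nonroot Ax e0.
  exists u, 0; rewrite u0 normr0 -horner2_swapXY -[A.[u, 0]]horner2_swapXY Bx.
  by rewrite horner0; split.
(* Both A and B are divisible by y, hence so is [r], and cancelling y lowers its size. *)
have [A' AE] := div0 _ Ax; have [B' BE] := div0 _ Bx.
have Bez' : 'Y * (U * A' + V * B') = r%:P by rewrite -Bez AE BE; ring.
set W := U * A' + V * B' in Bez'.
have WC : W = (W`_0)%:P.
  apply/polyP => -[|i]; rewrite coefC //=; apply: (@mulfI _ 'X).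
    by rewrite polyX_eq0.
  by rewrite -coefCM Bez' coefC mulr0.
have rE : r = 'X * W`_0 by rewrite -coefCM Bez' coefC.
have W0 : W`_0 != 0 by apply: contraNneq r0 => W0; rewrite rE W0 mulr0.
have Y0 : 'Y != 0 :> R2 by rewrite polyC_eq0 polyX_eq0.
have [| | |A2 [B2 [AB B20 H]]] := IH A' B' W`_0 _ _ W0.
- by rewrite -ltnS (leq_trans _ rn) // rE mulrC size_mulX.
- by apply: contraNneq B0 => B'0; rewrite BE B'0 mulr0.
- by rewrite -WC.
exists A2, B2; split=> //; rewrite AE BE.
by rewrite -mulrA AB mulrCA.
Qed.

Lemma regular_or_pole0 (A B : R2) : B != 0 ->
  exists A' B' : R2,
    [/\ A * B' = A' * B, B' != 0 & B'.[0, 0] != 0 \/ has_pole0 A' B'].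
Proof.
move=> B0; have G0 : gcdp A B != 0 by rewrite gcdp_eq0 negb_and B0 orbT.
have := @coprimep_div_gcd _ A B; rewrite B0 orbT => /(_ isT).
move=> /Bezout_coprimepP[[U V]] /=; rewrite -size_poly_eq1 => /size_poly1P[r r0].
set G := gcdp A B in G0 *; set A1 := A %/ G; set B1 := B %/ G => Bez.
have := Pdiv.Idomain.divpK (dvdp_gcdl A B).
have := Pdiv.Idomain.divpK (dvdp_gcdr A B).
rewrite -/G -/A1 -/B1; set c2 := _ ^+ _; set c1 := _ ^+ _ => BG AG.
have c10 : c1 != 0 by rewrite expf_neq0 // lead_coef_eq0.
have c20 : c2 != 0 by rewrite expf_neq0 // lead_coef_eq0.
have B10 : B1 != 0.
  apply/eqP => B10; move: BG; rewrite B10 mul0r => /esym/eqP.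
  by rewrite -mul_polyC mulf_eq0 polyC_eq0 (negPf c20) (negPf B0).
(* Pseudo-division recovers A and B only up to the factors [c1] and [c2]; crossing these factors
   makes the new quotient equal to A / B. *)
have [| | |A2 [B2 [AB B20 H]]] := @regular_or_pole0_Bezout (c2 *: A1) (c1 *: B1)
   (c1 *: U) (c2 *: V) (c1 * c2 * r).
- by rewrite -mul_polyC mulf_neq0 ?polyC_eq0.
- by rewrite !mulf_neq0.
- by rewrite [RHS]polyCM mul_polyC -Bez -!mul_polyC polyCM; ring.
exists A2, B2; split=> //.
have E : A * (c1 *: B1) = c2 *: A1 * B.
  apply: (mulIf G0); rewrite -mulrA -!scalerAl BG.
  by rewrite mulrAC AG -!mul_polyC; ring.
have cB0 : c1 *: B1 != 0 by rewrite -mul_polyC mulf_neq0 ?polyC_eq0.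
by apply: (mulIf cB0); rewrite mulrAC E mulrAC AB mulrAC.
Qed.

Lemma regular_or_pole (A B : R2) (a b : F) : B != 0 ->
  exists A' B' : R2, [/\ A * B' = A' * B, B' != 0 &
    B'.[a, b] != 0 \/ forall e : F, 0 < e -> exists u v : F,
      [/\ (u, v) <> (a, b), `|u - a| < e, `|v - b| < e,
          B'.[u, v] = 0 & A'.[u, v] != 0]].
Proof.
move=> B0; pose S := subst2 ('X + a%:P%:P) ('Y + b%:P%:P).
pose T := subst2 ('X - a%:P%:P) ('Y - b%:P%:P).
have TE (G : R2) x y : (T G).[x, y] = G.[x - a, y - b].
  by rewrite subst2E !hornerE.
have SB0 : S B != 0.
  by apply: contraNneq B0 => SB; rewrite -(subst2_shiftK a b B) -/S SB rmorph0.
have [A' [B' [AB B'0 H]]] := regular_or_pole0 (S A) SB0.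
exists (T A'), (T B'); split.
- rewrite -(subst2_shiftK a b A) -/S -/T -[X in _ = _ * X](subst2_shiftK a b B).
  by rewrite -!rmorphM /= AB rmorphM.
- apply: contraNneq B'0 => TB; apply/eqP; apply: poly2_vanish => x y.
  by rewrite -[x](addrK a) -[y](addrK b) -TE TB !horner0.
rewrite TE !subrr; case: H => [H|H]; [by left|right => e /H].
move=> [u [v [uv ue ve Buv Auv]]]; exists (u + a), (v + b).
rewrite !TE !addrK; split=> // -[/eqP ua /eqP vb]; move: uv.
by rewrite -[u == 0](inj_eq (addIr a)) -[v == 0](inj_eq (addIr b)) !add0r ua vb.
Qed.
End Poles.

(** * Algebraic dependence *)


Section Dependence.
Variable F : fieldType.
Local Notation R2 := {poly {poly F}}.

(** The [g i] have at most [m * m] coefficients each, so the matrix of all coefficients has more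
    rows than columns and a nonzero left kernel. *)
Lemma linear_dependence (I : finType) (m : nat) (g : I -> R2) :
    (forall i, size (g i) <= m)%N -> (forall i, sizeY (g i) <= m)%N ->
    (m * m < #|I|)%N ->
  exists a : I -> F, (exists i, a i != 0) /\ \sum_i (a i)%:P%:P * g i = 0.
Proof.
move=> gX gY mI.
pose M := \matrix_(i < #|I|) mxvec (\matrix_(j < m, k < m) (g (enum_val i))`_j`_k).
have : kermx M != 0.
  rewrite kermx_eq0 /row_free; apply: contraTneq (rank_leq_col M) => ->.
  by rewrite -ltnNge.
case/rowV0Pn => v /sub_kermxP vM /rV0Pn[i vi].
exists (fun t => v 0 (enum_rank t)); split.
  by exists (enum_val i); rewrite enum_valK.
apply/polyP => j; apply/polyP => k; rewrite !coef0 !coef_sum /=.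
under eq_bigr do rewrite !coefCM.
have [jm|jm] := ltnP j m; last first.
  by apply: big1 => t _; rewrite (nth_default _ (leq_trans (gX t) jm)) coef0 mulr0.
have [km|km] := ltnP k m; last first.
  apply: big1 => t _; rewrite [_`_k](nth_default _ _) ?mulr0 //.
  exact: leq_trans (max_size_coefXY _ _) (leq_trans (gY t) km).
have := congr1 (fun N : 'rV_(m * m) => N 0 (mxvec_index (Ordinal jm) (Ordinal km))) vM.
rewrite mxE [RHS]mxE; apply: etrans; rewrite (reindex (@enum_val I predT)) /=.
  apply: eq_bigr => t _; rewrite enum_valK; congr (_ * _).
  by rewrite mxE mxvecE mxE.
exact/onW_bij/enum_val_bij.
Qed.

Lemma subst2X (f g : R2) : subst2 f g 'X = f.
Proof. by rewrite /subst2 map_polyX hornerX. Qed.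

Lemma subst2C (f g : R2) c : subst2 f g c%:P = (map_poly (polyC \o polyC) c).[g].
Proof. by rewrite /subst2 map_polyC hornerC. Qed.

Lemma size_monomial3 (T : idomainType) (f g h : {poly T}) (i j k n d : nat) :
  (size f <= d.+1)%N -> (size g <= d.+1)%N -> (size h <= d.+1)%N ->
  (i < n)%N -> (j < n)%N -> (k < n)%N ->
  (size (f ^+ i * g ^+ j * h ^+ k)%R <= (3 * d).+1 * n)%N.
Proof.
move=> fd gd hd i_n j_n k_n.
have pw (p : {poly T}) l : (size p <= d.+1)%N -> (l < n)%N ->
    (size (p ^+ l)%R <= d * n.-1 + 1)%N.
  move=> pd ln; apply: leq_trans (size_poly_exp_leq _ _) _.
  rewrite addn1 ltnS; apply: leq_mul; lia.
have := size_polyMleq (f ^+ i * g ^+ j) (h ^+ k).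
have := size_polyMleq (f ^+ i) (g ^+ j).
have := pw _ _ fd i_n; have := pw _ _ gd j_n; have := pw _ _ hd k_n.
nia.
Qed.

(** Dimension count: the n^3 monomials in f, g, z with exponents below n have degree below (3d + 1)n
    in each variable, so they span at most ((3d + 1)n)^2 dimensions. *)
Lemma algebraic_over_pair (f g z : R2) :
  exists M : {poly R2}, M != 0 /\ (map_poly (subst2 f g) M).[z] = 0.
Proof.
pose d := (size f + size g + size z + (sizeY f + sizeY g + sizeY z))%N.
(* Since n exceeds (3d + 1)^2, n^3 exceeds ((3d + 1)n)^2. *)
pose n' := ((3 * d).+1 ^ 2)%N; pose n := n'.+1.
pose h (t : 'I_n * 'I_n * 'I_n) := f ^+ t.1.1 * g ^+ t.1.2 * z ^+ t.2.
pose m := ((3 * d).+1 * n)%N.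
have [fX gX zX] : [/\ size f <= d.+1, size g <= d.+1 & size z <= d.+1]%N.
  by split; rewrite /d; lia.
have [fY gY zY] : [/\ sizeY f <= d.+1, sizeY g <= d.+1 & sizeY z <= d.+1]%N.
  by split; rewrite /d; lia.
have [|||a [[[[i j] k] aijk] sum0]] := @linear_dependence _ m h.
- by move=> [[i j] k]; apply: size_monomial3.
- move=> [[i j] k]; rewrite sizeYE !rmorphM !rmorphXn /=.
  by apply: size_monomial3 => //=; rewrite -sizeYE.
- rewrite !card_prod !card_ord.
  have -> : (m * m = n * n * n')%N by rewrite /m /n' expnS expn1; ring.
  by rewrite ltn_pmul2l ?muln_gt0.
pose E k i := \poly_(j < n) a (inord i, inord j, inord k).
pose M : {poly R2} := \poly_(k < n) \poly_(i < n) E k i.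
exists M; split.
  apply: contraNneq aijk => M0.
  have := congr1 (fun G : {poly R2} => G`_k`_i`_j) M0.
  by rewrite /M /E !(coef0, coef_poly, ltn_ord, inord_val) => ->.
rewrite -sum0 /M poly_def rmorph_sum horner_sum /=.
transitivity (\sum_(k < n) \sum_(i < n) \sum_(j < n)
   (a (i, j, k))%:P%:P * h (i, j, k)); last first.
  rewrite exchange_big; under eq_bigr do rewrite exchange_big.
  rewrite !pair_bigA /=.
  by apply: eq_bigr => -[[i' j'] k'] _.
apply: eq_bigr => k' _.
rewrite map_polyZ map_polyXn hornerZ hornerXn poly_def rmorph_sum mulr_suml /=.
apply: eq_bigr => i' _; rewrite -mul_polyC rmorphM rmorphXn /= subst2X subst2C.
rewrite /E poly_def rmorph_sum horner_sum !mulr_suml /=.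
apply: eq_bigr => j' _; rewrite map_polyZ map_polyXn hornerZ hornerXn /=.
by rewrite !inord_val /h /=; ring.
Qed.
End Dependence.

(** * The rational inverse *)


Section Eval3.
Variable F : numClosedFieldType.
Local Notation R2 := {poly {poly F}}.

Definition eval3 (u v t : F) (N : {poly R2}) : F :=
  (map_poly (horner_eval v \o horner_eval u%:P) N).[t].
HB.instance Definition _ u v t := GRing.RMorphism.copy (eval3 u v t)
  (horner_eval t \o map_poly (horner_eval v \o horner_eval u%:P)).

Lemma eval3C u v t (c : R2) : eval3 u v t c%:P = c.[u, v].
Proof. by rewrite /eval3 map_polyC hornerC. Qed.

Lemma eval3X u v t : eval3 u v t 'X = t.
Proof. by rewrite /eval3 map_polyX hornerX. Qed.

Lemma eval3Z u v t (c : R2) N : eval3 u v t (c *: N) = c.[u, v] * eval3 u v t N.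
Proof. by rewrite -mul_polyC rmorphM /= eval3C. Qed.
Lemma eval3D u v t N1 N2 : eval3 u v t (N1 + N2) = eval3 u v t N1 + eval3 u v t N2.
Proof. exact: rmorphD. Qed.

Lemma eval3B u v t N1 N2 : eval3 u v t (N1 - N2) = eval3 u v t N1 - eval3 u v t N2.
Proof. exact: rmorphB. Qed.
End Eval3.

Section RationalInverse.
Variables (F : numClosedFieldType) (f1 f2 q : {poly {poly F}}).
Local Notation R2 := {poly {poly F}}.
Hypothesis q0 : q != 0.
Hypothesis fiber1 : forall u v : F, q.[u, v] != 0 ->
  exists x y, [/\ f1.[x, y] = u, f2.[x, y] = v &
    forall x' y', f1.[x', y'] = u -> f2.[x', y'] = v -> x' = x /\ y' = y].
Local Notation phi := (subst2 f1 f2).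
Local Notation ev u v := (horner_eval v \o horner_eval u%:P).

(** Every point where q is nonzero is a value of (f1, f2), so [q * h] vanishes everywhere. *)
Lemma subst2_eq0 (h : R2) : phi h = 0 -> h = 0.
Proof.
move=> h0; apply: (mulfI q0); rewrite mulr0; apply: poly2_vanish => u v.
rewrite hornerM hornerM; have [->|quv] := eqVneq q.[u, v] 0; first by rewrite mul0r.
have [x [y [<- <- _]]] := fiber1 quv.
by rewrite -(subst2E _ _ h) h0 !horner0 mulr0.
Qed.

Lemma subst2_inj : injective phi.
Proof.
exact: raddf_inj subst2_eq0.
Qed.

Lemma generic_vanish (Q N : R2) : Q != 0 ->
  (forall x y, Q.[f1.[x, y], f2.[x, y]] != 0 -> N.[x, y] = 0) -> N = 0.
Proof.
move=> Q0 QN; have pQ0 : phi Q != 0 by apply: contra_neq Q0 => /subst2_eq0.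
apply: (mulfI pQ0); rewrite mulr0; apply: poly2_vanish => x y.
rewrite hornerM hornerM subst2E; have [->|] := eqVneq Q.[f1.[x, y], f2.[x, y]] 0.
  by rewrite mul0r.
by move/QN->; rewrite mulr0.
Qed.

Lemma horner_subst2 (N : {poly R2}) (z : R2) x y :
  (map_poly phi N).[z].[x, y] = eval3 f1.[x, y] f2.[x, y] z.[x, y] N.
Proof.
rewrite -[LHS]/(ev x y _) -horner_map -map_poly_comp /= /horner_eval.
congr (_.[_]); apply: eq_map_poly => c /=; rewrite /horner_eval.
exact: subst2E.
Qed.

(** Descent on the degree of [M]. When no smaller relation appears, M(u, v, T) has z as its only
    root at generic values (u, v), so it equals c (T - z)^d. Its coefficient of T^(d - 1) is then -
    d c z, which is a relation of degree 1 since d is nonzero in characteristic 0. *)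
Lemma linear_relation (z D : R2) (N1 N2 M : {poly R2}) :
    D != 0 -> phi D * 'X = (map_poly phi N1).[z] ->
    phi D * 'Y = (map_poly phi N2).[z] ->
    M != 0 -> (map_poly phi M).[z] = 0 ->
  exists l : {poly R2}, size l = 2 /\ (map_poly phi l).[z] = 0.
Proof.
move=> D0 DX DY.
have [n] := ubnP (size M); elim: n M => // n IH M Mn M0 Mz.
(* A polynomial killing [z] is a multiple of [M], unless its remainder is a
   smaller candidate for [M]. *)
have reduce (N : {poly R2}) : (map_poly phi N).[z] = 0 ->
    (exists l : {poly R2}, size l = 2 /\ (map_poly phi l).[z] = 0) \/
    forall u v t, (lead_coef M).[u, v] != 0 -> eval3 u v t M = 0 ->
      eval3 u v t N = 0.
  move=> Nz; have NE := Pdiv.Idomain.divp_eq N M.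
  have [R0|R0] := eqVneq (N %% M) 0.
    right=> u v t luv Mt; have := congr1 (eval3 u v t) NE.
    rewrite R0 addr0 rmorphM /= Mt mulr0 eval3Z !horner_exp.
    by move/eqP; rewrite mulf_eq0 expf_eq0 (negPf luv) andbF => /eqP.
  left; apply: (IH (N %% M)) R0 _.
    by move: Mn; rewrite ltnS; apply: leq_trans; rewrite ltn_modp.
  have := congr1 (fun G => (map_poly phi G).[z]) NE.
  rewrite map_polyZ hornerZ Nz mulr0 rmorphD rmorphM /= hornerD hornerM Mz.
  by rewrite mulr0 add0r => <-.
pose c3 : {rmorphism F -> {poly R2}} := polyC \o polyC \o polyC.
have c3E u v t a : eval3 u v t (c3 a) = a by rewrite eval3C !hornerC.
have N1E x y : D.[f1.[x, y], f2.[x, y]] * x = eval3 f1.[x, y] f2.[x, y] z.[x, y] N1.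
  by rewrite -horner_subst2 -DX !hornerE subst2E.
have N2E x y : D.[f1.[x, y], f2.[x, y]] * y = eval3 f1.[x, y] f2.[x, y] z.[x, y] N2.
  by rewrite -horner_subst2 -DY !hornerE subst2E.
pose D3 : {poly R2} := D%:P.
have D3E u v t : eval3 u v t D3 = D.[u, v] by exact: eval3C.
(* A root t of M defines a candidate preimage (a, b) = (N1 / D, N2 / D). Clearing denominators in a
   relation G(x, y) = g(f, z) yields a polynomial that kills [z]; by [reduce] it vanishes at t, so
   the relation also holds at (a, b). *)
have lift (G : R2) (g : {poly R2}) :
    (forall x y, eval3 f1.[x, y] f2.[x, y] z.[x, y] g = G.[x, y]) ->
    (exists l : {poly R2}, size l = 2 /\ (map_poly phi l).[z] = 0) \/
    forall u v t a b, (lead_coef M).[u, v] != 0 -> D.[u, v] != 0 ->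
      eval3 u v t M = 0 -> D.[u, v] * a = eval3 u v t N1 ->
      D.[u, v] * b = eval3 u v t N2 -> G.[a, b] = eval3 u v t g.
  move=> gG; have [H [m HP]] := clear_denominators c3 G N1 N2 D3.
  have HE u v t a b : D.[u, v] * a = eval3 u v t N1 ->
      D.[u, v] * b = eval3 u v t N2 -> eval3 u v t H = D.[u, v] ^+ m * G.[a, b].
    by have := HP (eval3 u v t) a b (c3E u v t); rewrite /= D3E.
  have E u v t : eval3 u v t (H - (D ^+ m) *: g) =
      eval3 u v t H - D.[u, v] ^+ m * eval3 u v t g.
    by rewrite eval3B eval3Z !horner_exp.
  have [|?|red] := reduce (H - (D ^+ m) *: g); [|by left|right].
    apply: poly2_vanish => x y; rewrite horner_subst2 E.
    by rewrite (HE _ _ _ x y) // gG subrr.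
  move=> u v t a b luv Duv Mt Da Db; have := red u v t luv Mt.
  rewrite E (HE _ _ _ a b) // -mulrBr => /eqP.
  by rewrite mulf_eq0 expf_eq0 (negPf Duv) andbF /= subr_eq0 => /eqP.
(* Applied to f1, f2 and z: (a, b) lies over (u, v), and z(a, b) = t. *)
have [|//|L1] := lift f1 ('X)%:P.
  by move=> x y; rewrite eval3C hornerX hornerC.
have [|//|L2] := lift f2 ('Y)%:P.
  by move=> x y; rewrite eval3C hornerC hornerX.
have [|//|L3] := lift z 'X; first by move=> x y; rewrite eval3X.
have lM0 : lead_coef M != 0 by rewrite lead_coef_eq0.
have roots x y t : q.[f1.[x, y], f2.[x, y]] != 0 ->
    D.[f1.[x, y], f2.[x, y]] != 0 -> (lead_coef M).[f1.[x, y], f2.[x, y]] != 0 ->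
    eval3 f1.[x, y] f2.[x, y] t M = 0 -> t = z.[x, y].
  set u := f1.[x, y]; set v := f2.[x, y] => quv Duv luv Mt.
  have [x0 [y0 [_ _ uniq]]] := fiber1 quv.
  have [ex ey] := uniq x y erefl erefl.
  pose a := eval3 u v t N1 / D.[u, v]; pose b := eval3 u v t N2 / D.[u, v].
  have Da : D.[u, v] * a = eval3 u v t N1 by rewrite mulrC divfK.
  have Db : D.[u, v] * b = eval3 u v t N2 by rewrite mulrC divfK.
  have [|| ea eb] := uniq a b.
  - by rewrite (L1 u v t) // eval3C hornerX hornerC.
  - by rewrite (L2 u v t) // eval3C hornerC hornerX.
  by rewrite ex ey -ea -eb (L3 u v t) // eval3X.
have M1 : (1 < size M)%N.
  rewrite ltnNge; apply: contra M0 => /size1_polyC ME.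
  by move: Mz; rewrite ME map_polyC hornerC => /subst2_eq0 ->; rewrite polyC0.
pose d := (size M).-1.
have d0 : (0 < d)%N by rewrite /d -ltnS prednK // (ltn_trans _ M1).
have ld0 : lead_coef M *+ d != 0.
  rewrite -mulr_natr mulf_neq0 // -(rmorph_nat (polyC \o polyC)) /=.
  by rewrite !polyC_eq0 pnatr_eq0 -lt0n.
exists ((lead_coef M *+ d) *: 'X + (M`_d.-1)%:P); split.
  by rewrite -mul_polyC size_MXaddC polyC_eq0 (negPf ld0) /= size_polyC ld0.
apply: (@generic_vanish (q * D * lead_coef M)); first by rewrite !mulf_neq0.
move=> x y; rewrite 2!hornerM 2!hornerM !mulf_eq0 !negb_or -andbA.
move=> /and3P[quv Duv luv]; rewrite horner_subst2.
set u := f1.[x, y]; set v := f2.[x, y]; set t := z.[x, y].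
pose g := map_poly (ev u v) M.
have gl : lead_coef g = (lead_coef M).[u, v].
  by rewrite /g lead_coef_map_eq.
have gs : size g = size M by rewrite /g size_map_poly_id0.
have [rs gE] := closed_field_poly_normal g.
have rsz : size rs = d.
  by rewrite /d -gs gE size_scale ?gl // size_prod_XsubC.
have rst : all (pred1 t) rs.
  apply/allP => s srs /=; apply/eqP; apply: roots => //.
  rewrite /eval3 -/g; apply/eqP; rewrite -[_ == 0]/(root g s) gE rootZ ?gl //.
  by rewrite root_prod_XsubC.
(* Vieta: this coefficient is minus the leading one times the sum of the d roots, all equal to t. *)
have /(congr1 (fun p : {poly F} => p`_d.-1)) := gE.
rewrite coefZ -rsz coefPn_prod_XsubC ?rsz -?lt0n // coef_map gl.
rewrite (all_pred1P _ _ rst) rsz big_nseq iter_addr_0 /= => cd.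
rewrite eval3D eval3Z eval3X eval3C !hornerMn.
rewrite /horner_eval in cd; rewrite cd.
by rewrite mulrN mulrnAl mulrnAr subrr.
Qed.

Lemma rational_inverse : exists A1 B1 A2 B2 : R2,
  [/\ B1 != 0, B2 != 0, phi B1 * 'X = phi A1 & phi B2 * 'Y = phi A2].
Proof.
have [Mx [Mx0 MxX]] := algebraic_over_pair f1 f2 'X.
have [My [My0 MyY]] := algebraic_over_pair f1 f2 'Y.
have charR2 : [pchar R2] =i pred0.
  move=> p; rewrite !inE -(rmorph_nat (polyC \o polyC)) /= !polyC_eq0.
  by have := pchar_num F p; rewrite !inE.
have [z [D [N1 [N2 [D0 DX DY]]]]] :=
  primitive_element_domain charR2 subst2_inj Mx0 My0 MxX MyY.
have [Mz [Mz0 Mzz]] := algebraic_over_pair f1 f2 z.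
have [l [l2 lz]] := linear_relation D0 DX DY Mz0 Mzz.
have l0 : lead_coef l != 0 by rewrite lead_coef_eq0 -size_poly_eq0 l2.
(* Division by the linear [l] leaves a remainder free of T, so [w] becomes a quotient of
   pullbacks. *)
have clear (N : {poly R2}) (w : R2) : phi D * w = (map_poly phi N).[z] ->
    exists A B : R2, B != 0 /\ phi B * w = phi A.
  move=> Dw; have NE := Pdiv.Idomain.divp_eq N l.
  have : (size (N %% l)%R <= 1)%N.
    by rewrite -ltnS -[X in (_ < X)%N]l2 ltn_modp -lead_coef_eq0.
  move=> /size1_polyC RE.
  exists (N %% l)`_0, (lead_coef l ^+ scalp N l * D); split.
    by rewrite mulf_neq0 // expf_neq0.
  have := congr1 (fun G => (map_poly phi G).[z]) NE.
  rewrite map_polyZ hornerZ -Dw RE rmorphD rmorphM /= hornerD hornerM lz mulr0 add0r.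
  by rewrite map_polyC hornerC rmorphM /= mulrA coefC.
have [A1 [B1 [B10 E1]]] := clear _ _ DX.
have [A2 [B2 [B20 E2]]] := clear _ _ DY.
by exists A1, B1, A2, B2.
Qed.
End RationalInverse.

(** * Isolated omitted points *)


Section NoIsolated.
Variables (F : numClosedFieldType) (f1 f2 q : {poly {poly F}}).
Local Notation R2 := {poly {poly F}}.
Hypothesis q0 : q != 0.
Hypothesis fiber1 : forall u v : F, q.[u, v] != 0 ->
  exists x y, [/\ f1.[x, y] = u, f2.[x, y] = v &
    forall x' y', f1.[x', y'] = u -> f2.[x', y'] = v -> x' = x /\ y' = y].
Local Notation phi := (subst2 f1 f2).

Variables (a b e : F).
Hypothesis e0 : 0 < e.
Hypothesis near_image : forall u v, (u, v) <> (a, b) ->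
  `|u - a| < e -> `|v - b| < e -> exists x y, f1.[x, y] = u /\ f2.[x, y] = v.

Lemma regular_coordinate (A B w : R2) : B != 0 -> phi B * w = phi A ->
  exists A' B' : R2, B'.[a, b] != 0 /\ phi B' * w = phi A'.
Proof.
move=> B0 Bw; have [A' [B' [AB B'0 H]]] := regular_or_pole A a b B0.
have B'w : phi B' * w = phi A'.
  have pB0 : phi B != 0 by apply: contraNneq B0 => /(subst2_eq0 q0 fiber1) ->.
  apply: (mulIf pB0); rewrite -[RHS]rmorphM /= -AB rmorphM /= -Bw.
  by rewrite mulrAC -mulrA mulrC.
case: H => [?|/(_ _ e0)[u [v [uv ue ve Buv Auv]]]]; first by exists A', B'.
have [x [y [fu fv]]] := near_image uv ue ve; case/eqP: Auv.
have /(congr1 (fun G : R2 => G.[x, y])) := B'w.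
by rewrite !hornerM !subst2E fu fv Buv mul0r.
Qed.

Lemma isolated_point_in_image : exists x y, f1.[x, y] = a /\ f2.[x, y] = b.
Proof.
have [A1 [B1 [A2 [B2 [B10 B20 E1 E2]]]]] := rational_inverse q0 fiber1.
have {B10 E1}[A1' [B1' [B1ab E1]]] := regular_coordinate B10 E1.
have {B20 E2}[A2' [B2' [B2ab E2]]] := regular_coordinate B20 E2.
pose N1 := A1' * B2'; pose N2 := A2' * B1'; pose D := B1' * B2'.
have Dab : D.[a, b] != 0 by rewrite /D !hornerM mulf_neq0.
pose c2 : {rmorphism F -> R2} := polyC \o polyC.
(* D^m G(N1 / D, N2 / D) and D^m w are polynomials with the same pullback, hence equal; so they
   agree at (a, b) too, although it is not known to be a value. *)
have key (G w : R2) : phi w = G ->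
    G.[N1.[a, b] / D.[a, b], N2.[a, b] / D.[a, b]] = w.[a, b].
  move=> pw; have [H [m HP]] := clear_denominators c2 G N1 N2 D.
  have HE u v x y : D.[u, v] * x = N1.[u, v] -> D.[u, v] * y = N2.[u, v] ->
      H.[u, v] = D.[u, v] ^+ m * G.[x, y].
    have := HP (horner_eval v \o horner_eval u%:P) x y; apply => t /=.
    by rewrite /horner_eval !hornerC.
  have HD : H = D ^+ m * w.
    apply/eqP; rewrite -subr_eq0; apply/eqP/(subst2_eq0 q0 fiber1).
    apply: poly2_vanish => x y; rewrite subst2E !hornerD !hornerN !hornerM.
    rewrite !horner_exp (HE _ _ x y) -?pw ?subst2E ?subrr //.
    - have /(congr1 (fun G : R2 => G.[x, y])) := E1.
      rewrite !hornerM !subst2E hornerX hornerC => <-; ring.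
    - have /(congr1 (fun G : R2 => G.[x, y])) := E2.
      rewrite !hornerM !subst2E hornerC hornerX => <-; ring.
  have := HE a b (N1.[a, b] / D.[a, b]) (N2.[a, b] / D.[a, b]).
  rewrite ![_ * (_ / _)]mulrC !divfK // => /(_ erefl erefl).
  rewrite HD hornerM (hornerM (D ^+ m).[_]) !horner_exp => GE.
  by apply: (mulfI (expf_neq0 m Dab)).
exists (N1.[a, b] / D.[a, b]), (N2.[a, b] / D.[a, b]); split.
  by rewrite (key f1 'X) ?subst2X // hornerX hornerC.
by rewrite (key f2 'Y) ?hornerC ?hornerX // subst2C map_polyX hornerX.
Qed.

End NoIsolated.

(** * Multivariate polynomials as iterated polynomials *)

Section Bipoly.
Variable F : fieldType.

Definition bipoly (p : {mpoly F[2]}) : {poly {poly F}} :=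
  \sum_(m <- msupp p) (p@_m)%:P%:P * ('Y ^+ m ord_max) * 'X^(m ord0).

Lemma bipolyE (p : {mpoly F[2]}) (v : 'I_2 -> F) :
  (bipoly p).[v ord0, v ord_max] = p.@[v].
Proof.
rewrite /bipoly !horner_sum mevalE; apply: eq_bigr => m _.
rewrite !(hornerM, hornerC, hornerXn, horner_exp, hornerX).
rewrite big_ord_recl big_ord_recl big_ord0 mulr1.
have -> : lift ord0 ord0 = ord_max :> 'I_2 by apply: val_inj.
by rewrite -mulrA [_ ^+ m ord_max * _]mulrC.
Qed.

(** Distinct monomials go to distinct pairs of exponents, so the leading coefficient of [p] can be
    read off [bipoly p]. *)
Lemma bipoly_eq0 (p : {mpoly F[2]}) : bipoly p = 0 -> p = 0.
Proof.
move=> p0; apply/eqP; apply: contraT => /mlead_supp; rewrite mcoeff_msupp => ms.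
have := congr1 (fun h : {poly {poly F}} => h`_(mlead p ord0)`_(mlead p ord_max)) p0.
rewrite /bipoly !coef0 !coef_sum (bigD1_seq (mlead p)) ?msupp_uniq ?mcoeff_msupp //=.
rewrite -mulrA -rmorphXn /= !coefCM coefXn eqxx mulr1 coefXn eqxx mulr1.
rewrite big1_seq ?addr0.
  by move/eqP; rewrite (negPf ms).
move=> m /andP[mn _]; rewrite -mulrA -rmorphXn /= !coefCM coefXn.
have [e0|] := eqVneq (mlead p ord0) (m ord0); last by rewrite mulr0 coef0 mulr0.
have [e1|] := eqVneq (mlead p ord_max) (m ord_max); last first.
  by rewrite mulr1 coefXn => /negPf ->; rewrite mulr0.
case/eqP: mn; apply/mnmP => -[[|[|n]] i2] //.
- by rewrite (_ : Ordinal i2 = ord0) //; apply: val_inj.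
- by rewrite (_ : Ordinal i2 = ord_max) //; apply: val_inj.
Qed.
End Bipoly.

(** * The example for k >= 1 *)

Section Example.
Variables (F : numClosedFieldType) (k : nat).
Hypothesis k1 : (1 <= k)%N.

Definition fibre_poly (a b : F) : {poly F} := 'X ^+ k.+1 - b *: 'X + a%:P.

Lemma horner_fibre_poly a b t : (fibre_poly a b).[t] = t ^+ k.+1 - b * t + a.
Proof. by rewrite !(hornerE, hornerXn). Qed.

Lemma fibre_poly_monic_size a b :
  lead_coef (fibre_poly a b) = 1 /\ size (fibre_poly a b) = k.+2.
Proof.
have sm : (size (- (b *: 'X) + a%:P)%R < size ('X ^+ k.+1 : {poly F}))%N.
  rewrite size_polyXn (leq_ltn_trans (size_polyD _ _)) // gtn_max size_polyN.
  rewrite (leq_ltn_trans (size_scale_leq _ _)) ?size_polyX //.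
  by rewrite (leq_ltn_trans (size_polyC_leq1 _)).
by rewrite /fibre_poly -addrA lead_coefDl // size_polyDl // lead_coefXn size_polyXn.
Qed.

(** The hypothesis says that the discriminant is nonzero: a double root t would give b = (k + 1) t^k
    and a = k t^(k + 1), for which both sides agree. *)
Lemma fibre_poly_roots a b :
  k.+1%:R ^+ k.+1 * a ^+ k != k%:R ^+ k * b ^+ k.+1 ->
  exists rs : seq F, [/\ uniq rs, size rs = k.+1 &
    forall t, (t \in rs) = (t ^+ k.+1 - b * t + a == 0)].
Proof.
move=> disc; have [l1 sz] := fibre_poly_monic_size a b.
have [rs] := closed_field_poly_normal (fibre_poly a b); rewrite l1 scale1r => pE.
exists rs; split.
- rewrite -separable_prod_XsubC -pE unlock; apply: Pdiv.ClosedField.root_coprimep.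
  move=> t; rewrite /root horner_fibre_poly => /eqP pt; apply: contra disc => dt.
  have {dt} bE : b = k.+1%:R * t ^+ k.
    move: dt; rewrite /fibre_poly derivD derivB derivXn derivZ derivX derivC.
    rewrite addr0 hornerD hornerN hornerMn hornerXn hornerZ hornerC mulr1.
    by rewrite subr_eq0 -mulr_natl => /eqP.
  have aE : a = k%:R * t ^+ k.+1.
    rewrite -[a](addKr (t ^+ k.+1 - b * t)) pt addr0 bE -natr1 exprS. ring.
  by rewrite aE bE !exprMn -!exprM mulnC; apply/eqP; ring.
- by apply: eq_add_S; rewrite -sz pE size_prod_XsubC.
- by move=> t; rewrite -root_prod_XsubC -pE /root horner_fibre_poly.
Qed.

Definition example_map (x y : F) := (x * (x * y - 1), x + (x * y - 1) ^+ k).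

(** Let v = x y - 1 and x v = 0. If x = 0, then v = -1 and the second coordinate is (-1)^k. If v =
    0, then the second coordinate is x, and x = 0 would give v = -1. *)
Lemma example_map_neq0 x y : example_map x y <> (0, 0).
Proof.
move=> -[/eqP]; rewrite mulf_eq0 => /orP[/eqP->|/eqP v0].
  by rewrite mul0r sub0r add0r => /eqP; rewrite expf_eq0 oppr_eq0 oner_eq0 andbF.
rewrite v0 expr0n -[k == _]negbK -lt0n k1 addr0 => x0.
by move: v0; rewrite x0 mul0r sub0r => /eqP; rewrite oppr_eq0 oner_eq0.
Qed.

(** The value v determines the point: x = b - v^k is nonzero because a = x v is, and y = (v + 1) /
    x. Substituting x in a = x v gives the equation for v. *)
Lemma example_mapP a b x y : a != 0 -> example_map x y = (a, b) <->
  let v := x * y - 1 in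
  [/\ v ^+ k.+1 - b * v + a = 0, x = b - v ^+ k & y = (v + 1) / (b - v ^+ k)].
Proof.
move=> a0 /=; set v := x * y - 1; split=> [[xv xb]|[vE xE _]]; last first.
  rewrite /example_map -/v {2}xE subrK; congr (_, _); rewrite xE.
  by apply/eqP; rewrite -subr_eq0 -oppr_eq0 -vE; apply/eqP; rewrite exprS; ring.
rewrite -/v in xv xb; have xE : x = b - v ^+ k by rewrite -xb addrK.
have x0 : x != 0 by apply: contraNneq a0 => x0; rewrite -xv x0 mul0r.
split=> //; last by rewrite -xE subrK mulrC mulKf.
by rewrite -xv -xb exprS; ring.
Qed.

Lemma example_map_fiber a b : a != 0 ->
    k.+1%:R ^+ k.+1 * a ^+ k != k%:R ^+ k * b ^+ k.+1 ->
  exists s : seq (F * F), [/\ uniq s, size s = k.+1 &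
    forall x, example_map x.1 x.2 = (a, b) <-> x \in s].
Proof.
move=> a0 /fibre_poly_roots[rs [urs srs rsE]].
pose g v := (b - v ^+ k, (v + 1) / (b - v ^+ k)).
have gK : {in rs, cancel g (fun x => x.1 * x.2 - 1)}.
  move=> v; rewrite rsE /g /= => vE; rewrite mulrC divfK ?addrK //.
  apply: contraNneq a0 => bv; move: vE; rewrite (subr0_eq bv) exprS.
  by rewrite mulrC subrr add0r.
have inv0 (v : F) : v \in rs -> b - v ^+ k != 0.
  rewrite rsE exprS => vE; apply: contraNneq a0 => bv; move: vE.
  by rewrite (subr0_eq bv) mulrC subrr add0r.
exists (map g rs); split; first by rewrite map_inj_in_uniq //; apply: can_in_inj gK.
  by rewrite size_map.
move=> [x y]; split=> [/(example_mapP _ _ _ a0)/=[vE xE yE]|/mapP[v vrs ->]].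
  apply/mapP; exists (x * y - 1); first by rewrite rsE vE.
  by rewrite /g -yE -xE.
apply/(example_mapP _ _ _ a0); rewrite (gK v vrs) /=.
by split=> //; apply/eqP; rewrite -rsE.
Qed.

Lemma example_map_surj a b : (a, b) <> (0, 0) ->
  exists x y, example_map x y = (a, b).
Proof.
have [->|a0] := eqVneq a 0.
  have [->|b0 _] := eqVneq b 0; first by [].
  (* Taking y = 1 / x makes v = 0, so the image is (0, x). *)
  exists b, b^-1; rewrite /example_map divff // subrr mulr0 expr0n.
  by rewrite -[k == _]negbK -lt0n k1 addr0.
move=> _; have [t tE] : exists t, root (fibre_poly a b) t.
  by apply/closed_rootP; rewrite (fibre_poly_monic_size a b).2.
move: tE; rewrite /root horner_fibre_poly => /eqP tE.
have bt : b - t ^+ k != 0.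
  apply: contraNneq a0 => bt; move: tE; rewrite (subr0_eq bt) exprS.
  by rewrite mulrC subrr add0r => ->.
exists (b - t ^+ k), ((t + 1) / (b - t ^+ k)); apply/(example_mapP _ _ _ a0).
by rewrite [_ * (_ / _)]mulrC divfK // addrK.
Qed.
End Example.


Lemma bipoly_val2 (p : {mpoly C[2]}) (x y : C) :
  (bipoly p).[x, y] = p.@[val2 (x, y)].
Proof. by rewrite -bipolyE. Qed.

(** * The example as a polynomial map over the complex numbers *)

Section ExamplePolymap.
Variable k : nat.
Local Notation X := ('X_ord0 : {mpoly C[2]}).
Local Notation Y := ('X_ord_max : {mpoly C[2]}).

Definition example_polymap : {mpoly C[2]} * {mpoly C[2]} :=
  (X * (X * Y - 1), X + (X * Y - 1) ^+ k).

Lemma example_polymapE x : polymap example_polymap x = example_map k x.1 x.2.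
Proof.
rewrite /polymap /example_map /= mevalD rmorphXn /= mevalM mevalB mevalM meval1.
by rewrite !mevalXU.
Qed.

(** The line a = 0 together with the discriminant curve of T^(k + 1) - b T + a. *)
Definition example_curve : {mpoly C[2]} :=
  X * ((k.+1 ^ k.+1)%:R * X ^+ k - (k ^ k)%:R * Y ^+ k.+1).

Lemma example_curveE a b : example_curve.@[val2 (a, b)] =
  a * (k.+1%:R ^+ k.+1 * a ^+ k - k%:R ^+ k * b ^+ k.+1).
Proof.
rewrite mevalM mevalB !mevalM !rmorphXn /= !mevalXU !rmorph_nat !natrX.
by [].
Qed.

Lemma example_curve_neq0 : example_curve != 0.
Proof.
have : (example_curve).@[val2 (1, 0)] != 0.
  rewrite example_curveE expr1n expr0n mulr0 subr0 mul1r mulr1 -natrX pnatr_eq0.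
  by rewrite expn_eq0.
by apply: contraNneq => ->; rewrite meval0.
Qed.
End ExamplePolymap.

Theorem theorem1p5 (k : nat) :
  (exists P : {mpoly C[2]} * {mpoly C[2]},
      dominant (polymap P) /\
      generic_fiber_card (polymap P) k.+1 /\
      exists p : C * C, isolated_nonvalue (polymap P) p)
  <-> (1 <= k)%N.
Proof.
split=> [[P [_ [[q [q0 fib]] [[a b] [ab [e [e0 near]]]]]]]|k1].
  case: k fib => // fib; exfalso.
  have ev x y : polymap P (x, y) =
      ((bipoly P.1).[x, y], (bipoly P.2).[x, y]) by rewrite !bipoly_val2.
  have Q0 : bipoly q != 0 by apply: contraNneq q0 => /bipoly_eq0 ->.
  have fiber1 u v : (bipoly q).[u, v] != 0 -> exists x y,
      [/\ (bipoly P.1).[x, y] = u, (bipoly P.2).[x, y] = v &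
       forall x' y', (bipoly P.1).[x', y'] = u -> (bipoly P.2).[x', y'] = v ->
       x' = x /\ y' = y].
    rewrite bipoly_val2 => /fib[s [_ ss sP]].
    case: s ss sP => [|[x y] [|? ?]] // _ sP.
    have [fx fy] : (bipoly P.1).[x, y] = u /\ (bipoly P.2).[x, y] = v.
      by have := (sP (x, y)).2 (mem_head _ _); rewrite ev => -[].
    exists x, y; split=> // x' y' fx' fy'.
    have /(sP _).1 : polymap P (x', y') = (u, v) by rewrite ev fx' fy'.
    by rewrite mem_seq1 => /eqP[].
  (* [isolated_point_in_image] bounds each coordinate separately while [dist2] adds them, hence the
     half. *)
  have e20 : 0 < e / 2 by rewrite divr_gt0.
  have [|x [y [fx fy]]] := isolated_point_in_image Q0 fiber1 (a := a) (b := b) e20.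
    move=> u v uv ua vb.
    have [|[x y]] := near (u, v) uv; first by rewrite [e]splitr ltrD.
    by rewrite ev => -[<- <-]; exists x, y.
  by apply: (ab (x, y)); rewrite ev fx fy.
exists (example_polymap k); split; last split.
- move=> [a b] e e0.
  have [ab|ab] := eqVneq (a, b) (0, 0); last first.
    have [x [y xyE]] := example_map_surj k1 (elimN eqP ab).
    exists (x, y); rewrite example_polymapE xyE.
    by rewrite -[dist2 _ _]/(`|a - a| + `|b - b|) !subrr normr0 addr0.
  (* The origin, the only omitted point, is approached by the values (0, e / 2). *)
  have [x [y xyE]] : exists x y, example_map k x y = (0, e / 2).
    apply: example_map_surj => // -[/eqP]; by rewrite gt_eqF // divr_gt0.
  exists (x, y); rewrite example_polymapE xyE ab.
  rewrite -[dist2 _ _]/(`|0 - 0| + `|e / 2 - 0|) !subr0 normr0 add0r.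
  by rewrite gtr0_norm ?divr_gt0 // ltr_pdivrMr // ltr_pMr // ltr1n.
- exists (example_curve k); rewrite example_curve_neq0; split=> // -[a b].
  rewrite example_curveE mulf_eq0 negb_or subr_eq0 => /andP[a0 disc].
  have [s [us ss sE]] := example_map_fiber k1 a0 disc.
  by exists s; split=> // x; rewrite example_polymapE.
- exists (0, 0); split=> [x|].
    by rewrite example_polymapE; apply: example_map_neq0.
  exists 1; split=> // -[a b] ab _; have [x [y xyE]] := example_map_surj k1 ab.
  by exists (x, y); rewrite example_polymapE.
Qed.
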